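(* Suppose $A$ is a pointed type with a unique H-space structure which is left-invertible. Then the H-space structure is necessarily associative.
   Context: We work in homotopy type theory with a univalent universe. A (coherent) H-space structure on a pointed type $A$ with base point $\mathrm{pt}$ consists of an operation $\mu : A \to A \to A$, unit laws $\mu_l : \mu(\mathrm{pt},-) = \mathrm{id}_A$ and $\mu_r : \mu(-,\mathrm{pt}) = \mathrm{id}_A$, and a coherence $\mu_l(\mathrm{pt}) = \mu_r(\mathrm{pt})$. $A$ has a unique H-space structure if the type $\mathrm{HSpace}(A)$ of all such structures is contractible. A structure is left-invertible if $\mu(a,-) : A \to A$ is an equivalence for all $a : A$, and associative if there is a homotopy $\prod_{a,b,c:A} \mu(\mu(a,b),c) = \mu(a,\mu(b,c))$. *)

(* Defs.v *)
Set Implicit Arguments.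
Unset Strict Implicit.
Unset Printing Implicit Defensive.

(* The identity types of homotopy type theory.  They are [Type]-valued, rather
   than Rocq's [Prop]-valued [eq], because a type of structures such as
   [HSpace A] below contains paths as proof-relevant data. *)
Inductive paths (A : Type) (a : A) : A -> Type := idpath : paths a a.

Record Contr (A : Type) : Type := {
  center : A;
  contraction : forall x : A, paths center x
}.

Definition fiber (A B : Type) (f : A -> B) (b : B) : Type :=
  {a : A & paths (f a) b}.

Definition IsEquiv (A B : Type) (f : A -> B) : Type :=
  forall b : B, Contr (fiber f b).

Definition happly (A : Type) (P : A -> Type) (f g : forall x : A, P x)
    (p : paths f g) : forall x : A, paths (f x) (g x) :=
  match p with idpath _ => fun x => idpath (f x) end.

(* The only consequence of univalence that is assumed.  Univalence of [Type]
   itself is deliberately not a hypothesis: through [eq], Rocq makes every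
   identity type equivalent to one in the impredicative sort [Prop], and the
   hypothesis would also contradict UIP, so it could make a statement vacuous. *)
Definition Funext : Type :=
  forall (A : Type) (P : A -> Type) (f g : forall x : A, P x),
    IsEquiv (@happly A P f g).

Record pType : Type := {
  carrier :> Type;
  pt : carrier
}.

Arguments pt {_}.

(* The unit laws are identities between functions; the coherence compares the
   two resulting paths from [mu pt pt] to [pt]. *)
Record HSpace (A : pType) : Type := {
  mu :> A -> A -> A;
  mu_l : paths (mu pt) (fun a : A => a);
  mu_r : paths (fun a : A => mu a pt) (fun a : A => a);
  mu_coh : paths (happly mu_l pt) (happly mu_r pt)
}.

Definition left_invertible (A : pType) (m : HSpace A) : Type :=
  forall a : A, IsEquiv (m a).

Definition associative (A : pType) (m : HSpace A) : Type :=
  forall a b c : A, paths (m (m a b) c) (m a (m b c)).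

Definition unique_HSpace (A : pType) : Type := Contr (HSpace A).

(* Main.v *)
Require Import Defs.

(** The idea is to conjugate the multiplication by its own left translations.
    Since [m a] is invertible for every [a], one can form
<<
      m_a b c  :=  a \ ((a b) c),
>>
    where [a \ -] is the inverse of [m a].  Each [m_a] is again a coherent
    H-space structure.  The unit laws come from [m_r] and the cancellation
    [a \ (a x) = x].  The coherence asks that the two ways of contracting
    [(a pt) pt] to [a pt] agree, and they do by naturality of [m_r] at the path
    [m_r a : a pt = a].  By uniqueness [m_a] and [m] have the same operation,
    so [a \ ((a b) c) = b c], and multiplying by [a] on the left gives
    associativity. *)

Definition inverse {A : Type} {a b : A} (p : paths a b) : paths b a :=
  match p with idpath _ => idpath a end.

Definition concat {A : Type} {a b c : A} (p : paths a b) :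
    paths b c -> paths a c :=
  match p with idpath _ => fun q => q end.

Definition ap {A B : Type} (f : A -> B) {a b : A} (p : paths a b) :
    paths (f a) (f b) :=
  match p with idpath _ => idpath (f a) end.

Lemma ap_compose {A B C : Type} (f : A -> B) (g : B -> C) {a b : A}
    (p : paths a b) : paths (ap (fun x => g (f x)) p) (ap g (ap f p)).
Proof. destruct p. apply idpath. Defined.

Lemma concat_idpath {A : Type} {a b : A} (p : paths a b) :
  paths (concat p (idpath b)) p.
Proof. destruct p. apply idpath. Defined.

Lemma concat_cancel_r {A : Type} {a b c : A} (p q : paths a b)
    (s : paths b c) : paths (concat p s) (concat q s) -> paths p q.
Proof.
  destruct s. intros h.
  exact (concat (inverse (concat_idpath p)) (concat h (concat_idpath q))).
Defined.

Lemma homotopy_id_natural {A : Type} (f : A -> A)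
    (r : forall x, paths (f x) x) {x y : A} (p : paths x y) :
  paths (concat (ap f p) (r y)) (concat (r x) p).
Proof. destruct p. exact (inverse (concat_idpath (r x))). Defined.

(** Naturality of the homotopy [r] along its own component [r x : f x = x]
    has [r x] as last factor on both sides; cancelling it leaves this. *)
Lemma ap_homotopy_id {A : Type} (f : A -> A) (r : forall x, paths (f x) x)
    (x : A) : paths (ap f (r x)) (r (f x)).
Proof. exact (concat_cancel_r _ _ _ (homotopy_id_natural f r (r x))). Defined.

Definition equiv_inv {A B : Type} {f : A -> B} (e : IsEquiv f) (b : B) : A :=
  projT1 (center (e b)).

Lemma equiv_inv_section {A B : Type} {f : A -> B} (e : IsEquiv f) (b : B) :
  paths (f (equiv_inv e b)) b.
Proof. exact (projT2 (center (e b))). Defined.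

Lemma equiv_inv_retraction {A B : Type} {f : A -> B} (e : IsEquiv f) (a : A) :
  paths (equiv_inv e (f a)) a.
Proof.
  exact (ap (@projT1 _ _)
    (contraction (e (f a)) (existT _ a (idpath (f a))))).
Defined.

(** The unit laws of an H-space are identities between functions, so pointwise
    laws have to be sent through [funext]; it is the computation rule
    [happly (funext h) = h] that lets the pointwise coherence survive. *)
Definition HSpace_pointwise (funext : Funext) (A : pType) (op : A -> A -> A)
    (l : forall a, paths (op pt a) a) (r : forall a, paths (op a pt) a)
    (coh : paths (l pt) (r pt)) : HSpace A.
Proof.
  pose (el := funext A (fun _ => carrier A) (op pt) (fun a => a)).
  pose (er := funext A (fun _ => carrier A) (fun a => op a pt) (fun a => a)).
  refine (@Build_HSpace A op (equiv_inv el l) (equiv_inv er r) _).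
  refine (concat (ap (fun h => h pt) (equiv_inv_section el l)) _).
  refine (concat coh _).
  exact (inverse (ap (fun h => h pt) (equiv_inv_section er r))).
Defined.

(** The operation [b, c |-> a \ ((a b) c)].  Its left unit law is obtained from
    [m_r a : a pt = a] and its right unit law from [m_r (a b)], so at the base
    point the two differ as [ap (- pt) (m_r a)] and [m_r (a pt)] do, which are
    equal by [ap_homotopy_id]. *)
Definition HSpace_conjugate (funext : Funext) (A : pType) (m : HSpace A)
    (linv : left_invertible m) (a : A) : HSpace A.
Proof.
  pose (r := happly (mu_r m)).
  refine (@HSpace_pointwise funext A
    (fun b c => equiv_inv (linv a) (m (m a b) c))
    (fun c => concat
       (ap (fun x => equiv_inv (linv a) (m x c)) (r a))
       (equiv_inv_retraction (linv a) c))
    (fun b => concat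
       (ap (equiv_inv (linv a)) (r (m a b)))
       (equiv_inv_retraction (linv a) b)) _).
  refine (ap (fun p => concat p (equiv_inv_retraction (linv a) pt)) _).
  refine (concat _ (ap (ap (equiv_inv (linv a)))
    (ap_homotopy_id (fun x => m x pt) r a))).
  apply (ap_compose (fun x => m x pt)).
Defined.

Theorem proposition2p35 (funext : Funext) (A : pType)
    (uniq : unique_HSpace A) (linv : left_invertible (center uniq)) :
  associative (center uniq).
Proof.
  intros a b c.
  pose (m := center uniq).
  assert (conj : paths (m b c) (equiv_inv (linv a) (m (m a b) c))).
  { exact (ap (fun n : HSpace A => n b c)
      (contraction uniq (HSpace_conjugate funext A m linv a))). }
  refine (concat (inverse (equiv_inv_section (linv a) (m (m a b) c))) _).
  exact (ap (m a) (inverse conj)).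
Qed.
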